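(* Let $G$ be a finite simple undirected graph (no loops, no parallel edges) on the vertex set $A_n=\{0,1,\ldots,n-1\}$. There exists an infinite square-free $G$-word if and only if $G$ has a connected subgraph isomorphic to one of the graphs $C_3,\ C_4,\ C_5,\ P_5,\ K_{1,3}$. Moreover, if $G$ has a subgraph $C_3$ or a subgraph $P_m$ with $m\ge 5$, then $\gamma(G)=3$; and if $G$ is $C_4$ or $K_{1,3}$, then $\gamma(G)=4$.
   Context: A word over $A_k=\{0,\ldots,k-1\}$ is a finite sequence of letters; an infinite word is a sequence $i_1i_2\cdots$ of letters. A finite or infinite word is square-free if it has no factor (contiguous block) of the form $uu$ with $u$ nonempty. A finite or infinite word $w=i_1i_2\cdots$ over $A_n$ is a $G$-word if each consecutive pair $i_ji_{j+1}$ is an edge of $G$ (i.e. $w$ is a walk in $G$). A $k$-colouring of $G$ is a map $\varphi\colon A_n\to A_k$, extended letterwise to words. $\gamma(G)$ is the smallest $k$ (if it exists) such that there is an infinite $G$-word $w$ and a $k$-colouring $\varphi$ with $\varphi(w)$ square-free. $P_m$ is the path on $A_m$ with edges $i(i+1)$, $0\le i\le m-2$; $C_m$ is the cycle on $A_m$ with edges $i(i+1)$ (indices mod $m$); $K_{1,3}$ (the claw) is the graph on $A_4$ with edges $01,02,03$. Subgraphs need not be induced. *)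

(* Defs.v *)
From mathcomp Require Import all_boot.
Set Implicit Arguments.
Unset Strict Implicit.
Unset Printing Implicit Defensive.

(* The alphabet A_k is 'I_k, and an infinite word i_1 i_2 ... over A_k is the
   function sending j to i_(j+1). *)
Definition inf_word (k : nat) := nat -> 'I_k.

Definition factor (k : nat) (v : seq 'I_k) (w : inf_word k) : Prop :=
  exists i : nat, v = [seq w (i + j) | j <- iota 0 (size v)].

Definition square_free (k : nat) (w : inf_word k) : Prop :=
  forall u : seq 'I_k, u <> [::] -> ~ factor (u ++ u) w.

Definition G_word (n : nat) (G : rel 'I_n) (w : inf_word n) : Prop :=
  forall j : nat, G (w j) (w j.+1).

(* A colouring is an arbitrary map on vertices: it need not be proper. *)
Definition square_free_colourable (n : nat) (G : rel 'I_n) (k : nat) : Prop :=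
  exists (w : inf_word n) (phi : 'I_n -> 'I_k),
    G_word G w /\ square_free (phi \o w).

(* gamma is a partial function of the graph, so it is given by its graph:
   [gamma_is G k] says that gamma(G) exists and equals k. *)
Definition gamma_is (n : nat) (G : rel 'I_n) (k : nat) : Prop :=
  square_free_colourable G k /\
  forall k' : nat, square_free_colourable G k' -> k <= k'.

Definition path_graph (m : nat) : rel 'I_m :=
  fun i j => (j == i.+1 :> nat) || (i == j.+1 :> nat).

(* [cycle_graph m] is a simple graph only for m >= 3. *)
Definition cycle_graph (m : nat) : rel 'I_m :=
  fun i j => (j == i.+1 %% m :> nat) || (i == j.+1 %% m :> nat).

Definition claw : rel 'I_4 :=
  fun i j => ((i == 0 :> nat) && (j != 0 :> nat)) ||
             ((j == 0 :> nat) && (i != 0 :> nat)).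

(* A subgraph is a vertex set V with an edge relation F on V; it need not be
   induced. *)
Definition subgraph (T : finType) (G : rel T) (V : {set T}) (F : rel T) : Prop :=
  symmetric F /\ forall x y, F x y -> [/\ x \in V, y \in V & G x y].

Definition connected_graph (T : finType) (V : {set T}) (F : rel T) : Prop :=
  {in V &, forall x y, connect F x y}.

(* The graph with vertex set V and edge relation F is isomorphic to H. *)
Definition graph_iso (T U : finType) (V : {set T}) (F : rel T) (H : rel U) : Prop :=
  exists f : U -> T,
    [/\ injective f, f @: [set: U] = V & forall x y, F (f x) (f y) = H x y].

Definition has_subgraph (T U : finType) (G : rel T) (H : rel U) : Prop :=
  exists (V : {set T}) (F : rel T), subgraph G V F /\ graph_iso V F H.

Definition has_connected_subgraph (T U : finType) (G : rel T) (H : rel U) : Prop :=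
  exists (V : {set T}) (F : rel T),
    [/\ subgraph G V F, connected_graph V F & graph_iso V F H].

(* Main.v *)
Require Import Defs.
From mathcomp Require Import all_boot.
From mathcomp Require Import zify.
Set Implicit Arguments.
Unset Strict Implicit.
Unset Printing Implicit Defensive.

(* Let t be the Thue-Morse word, which is overlap-free. The walk on the path
   0-1-2-3-4 that is at 1 + 2 t_i at time 2 i and at 2 (t_i + t_(i+1)) at time
   2 i + 1 is square-free after reduction modulo 3 (a 3-colouring of P_5) and
   modulo 4 (folding P_5 onto C_4): squares of even period give overlaps in t, and
   squares of odd period fail because even and odd times use different letters,
   up to runs xxx in t. The ternary word so obtained is
   itself a walk on C_3, and interleaved with a centre letter it is a walk on the
   claw; C_5 contains P_5.
   Conversely, in a graph without C_3, C_4, P_5 and claw, the vertices visited by a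
   walk lie on a path with at most four vertices, whose square-free walks are finite.
   With three colours, a walk on C_4 or on the claw either sees one colour at every
   other step, leaving a binary word, or avoids an edge of C_4 and lives on P_4. *)

(** * Square-freeness in terms of positions and periods, over an arbitrary alphabet *)

Definition squarefree (T : Type) (z : nat -> T) : Prop :=
  forall i p, 0 < p -> ~ (forall j, j < p -> z (i + j) = z (i + p + j)).

Lemma square_freeP (k : nat) (w : inf_word k) : square_free w <-> squarefree w.
Proof.
split=> sqf.
  move=> i p p_gt0 sq.
  pose u := [seq w (i + j) | j <- iota 0 p].
  apply: (sqf u); first by case: p p_gt0 @u {sq}.
  exists i; rewrite size_cat size_map size_iota iotaD map_cat add0n; congr (_ ++ _).
  rewrite -[X in iota X p]addn0 iotaDl -map_comp /u.
  apply/eq_in_map=> j; rewrite mem_iota add0n => /andP[_ ltjp] /=.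
  by rewrite sq // addnA.
case=> [|x u] // _ [i eq_uu]; set v := x :: u in eq_uu.
apply: (sqf i (size v)) => // j ltjv.
have nthE l : l < size v + size v -> nth x (v ++ v) l = w (i + l).
  by move=> ltl; rewrite eq_uu (nth_map 0) ?size_iota ?size_cat // nth_iota ?add0n.
rewrite -addnA -!nthE ?ltn_add2l //; last exact: ltn_addr.
by rewrite !nth_cat ltjv ltnNge leq_addr addKn.
Qed.

Lemma squarefree_comp (S T : Type) (f : S -> T) (z : nat -> S) :
  squarefree (f \o z) -> squarefree z.
Proof. by move=> sqf i p p_gt0 sq; apply: (sqf i p p_gt0) => j /sq /= ->. Qed.

Lemma eq_squarefree (T : Type) (z z' : nat -> T) :
  z =1 z' -> squarefree z -> squarefree z'.
Proof. by move=> eqz sqf i p /sqf sq sq'; apply: (sq i) => j; rewrite !eqz; apply: sq'. Qed.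

Lemma squarefree_inj (S T : Type) (f : S -> T) (z : nat -> S) :
  injective f -> squarefree z -> squarefree (f \o z).
Proof. by move=> f_inj sqf i p /sqf sq eqfz; apply: (sq i) => j /eqfz /f_inj. Qed.

Lemma squarefree_adj (T : Type) (z : nat -> T) i : squarefree z -> z i <> z i.+1.
Proof.
by move=> sqf eqz; apply: (sqf i 1) => // -[|//] _; rewrite !addn0 addn1.
Qed.

(** Adjacent letters differ, so two letters must alternate, which gives a square of period 2. *)
Lemma squarefree_binary (T : Type) (z : nat -> T) x y :
  (forall i, z i = x \/ z i = y) -> ~ squarefree z.
Proof.
move=> zxy sqf; have adj := squarefree_adj (i := _) sqf.
have z2 i : z i.+2 = z i.
  have := adj i; have := adj i.+1.
  by case: (zxy i) (zxy i.+1) (zxy i.+2) => -> [] -> [] ->.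
by apply: (sqf 0 2) => // -[|[|//]] _; rewrite z2.
Qed.

(** * The Thue-Morse word *)

(** [k] is fuel: the result is the sum modulo 2 of the [k] lowest binary digits of [i]. Fuel [i]
    already reaches every digit. *)
Fixpoint bit_parity (k i : nat) : bool :=
  if k is k'.+1 then odd i (+) bit_parity k' i./2 else false.

Definition thue_morse (i : nat) : bool := bit_parity i i.

Lemma bit_parity_stable k i : i <= k -> bit_parity k i = thue_morse i.
Proof.
rewrite /thue_morse; elim/ltn_ind: i k => -[|i] IH k.
  by move=> _; elim: k => //= k ->.
case: k => // k leik /=; congr (_ (+) _).
have h : uphalf i < i.+1 by lia.
by rewrite !(IH _ h) //; lia.
Qed.

Lemma thue_morseE i : thue_morse i = odd i (+) thue_morse i./2.
Proof.
case: i => // i; rewrite {1}/thue_morse /=; congr (_ (+) _).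
by apply: bit_parity_stable; lia.
Qed.

Lemma thue_morse_double i : thue_morse i.*2 = thue_morse i.
Proof. by rewrite thue_morseE odd_double doubleK. Qed.

Lemma thue_morse_doubleS i : thue_morse i.*2.+1 = ~~ thue_morse i.
Proof. by rewrite thue_morseE /= odd_double uphalf_double. Qed.

Lemma thue_morse_even_adj i : ~~ odd i -> thue_morse i.+1 = ~~ thue_morse i.
Proof. by move=> /even_halfK <-; rewrite thue_morse_doubleS thue_morse_double. Qed.

(** Descent on the period. For even [p], the positions with the parity of [i] carry an overlap of
    half the period. For odd [p], the word alternates through a whole period, so its ends differ
    although the overlap makes them equal. *)
Lemma thue_morse_overlap_free i p :
  0 < p -> ~ (forall j, j <= p -> thue_morse (i + j) = thue_morse (i + p + j)).
Proof.
elim/ltn_ind: p i => p IH i p_gt0 ov.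
have [p_odd|p_even] := boolP (odd p).
  (* For odd p every adjacent pair in the first period, or its translate by p,
     starts at an even position, so the period alternates. *)
  have alt j : j < p -> thue_morse (i + j).+1 = ~~ thue_morse (i + j).
    move=> ltjp; have [ij_odd|] := boolP (odd (i + j)); last exact: thue_morse_even_adj.
    rewrite -addnS !ov ?(ltnW ltjp) // addnS thue_morse_even_adj //.
    by rewrite addnAC oddD ij_odd p_odd.
  have altE j : j <= p -> thue_morse (i + j) = odd j (+) thue_morse i.
    elim: j => [|j IHj] ltjp; first by rewrite addn0.
    by rewrite addnS alt // IHj ?(ltnW ltjp) // addNb.
  have := ov 0 isT; rewrite !addn0 altE // p_odd.
  by case: thue_morse.
rewrite -(even_halfK p_even) in p_gt0 ov IH; move: p./2 => q in p_gt0 ov IH.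
apply: (IH q _ i./2) => [||j lejq]; [lia | lia |].
have shift m : thue_morse (i + m.*2) = odd i (+) thue_morse (i./2 + m).
  by rewrite thue_morseE oddD odd_double addbF; congr (_ (+) thue_morse _); lia.
have := ov j.*2; rewrite leq_double -addnA -doubleD !shift addnA => /(_ lejq).
exact: addbI.
Qed.

(** * Square-free walks in the four basic graphs *)

(** A square of even period 2q matches q letters coded by [E] with their translates by q. A pair at
    the border yields one more match: one of its two letters is already matched, and [D] is
    injective in the other. Together these form an overlap of period q. *)
Lemma interleave_square_odd (T : Type) (E : bool -> T) (D : bool -> bool -> T)
    (z : nat -> T) i p :
  (forall j, z j.*2 = E (thue_morse j)) ->
  (forall j, z j.*2.+1 = D (thue_morse j) (thue_morse j.+1)) ->
  injective E -> (forall x, injective (D x)) -> (forall y, injective (D^~ y)) ->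
  0 < p -> (forall j, j < p -> z (i + j) = z (i + p + j)) -> odd p.
Proof.
move=> zE zD injE injDr injDl p_gt0 sq; apply/negPn/negP=> p_even.
rewrite -(even_halfK p_even) in p_gt0 sq; move: p./2 => q in p_gt0 sq.
have sqE j : i <= j.*2 < i + q.*2 -> thue_morse j = thue_morse (j + q).
  move=> ij; apply: injE; rewrite -!zE.
  have := sq (j.*2 - i); rewrite addnAC subnKC; last by lia.
  by rewrite doubleD; apply; lia.
have sqD j : i <= j.*2.+1 < i + q.*2 -> D (thue_morse j) (thue_morse j.+1) =
    D (thue_morse (j + q)) (thue_morse (j + q).+1).
  move=> ij; rewrite -!zD.
  have := sq (j.*2.+1 - i); rewrite addnAC subnKC; last by lia.
  by rewrite doubleD; apply; lia.
apply: (@thue_morse_overlap_free i./2 q) => [|j lejq]; first by lia.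
rewrite addnAC; have: i./2 <= i./2 + j <= i./2 + q by lia.
move: (i./2 + j) => m im.
have [inm|/negP outm] := boolP (i <= m.*2 < i + q.*2); first exact: sqE.
(* The only even position left is just before the first half of the square if [i] is odd, and just
   after it if [i] is even. *)
have [ltm|gem] := ltnP m.*2 i.
  have := sqD m; have := sqE m.+1; rewrite addSn => -> => [h|]; last by lia.
  by apply: injDl (h _); lia.
case: m => [|m] in im outm gem *; first by case: outm; lia.
have := sqD m; rewrite sqE => [h|]; last by lia.
by rewrite addSn; apply: injDr (h _); lia.
Qed.

(* Vertices of the path 0-1-2-3-4: the walk is at 1 or 3 at even times according
   to the Thue-Morse word, and in between passes through 2 if the letter changes
   and turns at an end of the path otherwise. *)
Definition path5_walk (k : nat) : nat :=
  let i := k./2 in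
  if odd k then (thue_morse i + thue_morse i.+1).*2 else (thue_morse i).*2.+1.

Lemma path5_walk_even i : path5_walk i.*2 = (thue_morse i).*2.+1.
Proof. by rewrite /path5_walk odd_double doubleK. Qed.

Lemma path5_walk_odd i :
  path5_walk i.*2.+1 = (thue_morse i + thue_morse i.+1).*2.
Proof. by rewrite /path5_walk /= odd_double uphalf_double. Qed.

Lemma path5_walk_lt5 k : path5_walk k < 5.
Proof. by rewrite /path5_walk; case: odd; do 2?[case: thue_morse]. Qed.

Lemma path5_walk_adj k :
  path5_walk k.+1 = (path5_walk k).+1 \/ path5_walk k = (path5_walk k.+1).+1.
Proof.
rewrite -(odd_double_half k); case: odd; rewrite ?add0n ?add1n.
  rewrite -doubleS path5_walk_even path5_walk_odd.
  by do 2![case: thue_morse]; auto.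
by rewrite path5_walk_even path5_walk_odd; do 2![case: thue_morse]; auto.
Qed.

Lemma path5_walk_mod3_squarefree : squarefree (fun k => path5_walk k %% 3).
Proof.
move=> i p p_gt0 sq.
have p_odd : odd p.
  apply: (@interleave_square_odd _ (fun x : bool => x.*2.+1 %% 3)
    (fun x y : bool => (x + y).*2 %% 3) (fun k => path5_walk k %% 3) i p) => //.
  - by move=> j; rewrite path5_walk_even.
  - by move=> j; rewrite path5_walk_odd.
  - by do 2!case.
  - by do 3!case.
  - by do 3!case.
have eq_adj j : i <= j.*2.+1 < i + p.*2 -> thue_morse j.+1 = thue_morse j.
  (* Colour 2 occurs only at odd times, hence never in an odd-period square. *)
  move=> ij; have: path5_walk j.*2.+1 %% 3 <> 2.
    have ne2 m : ~~ odd m -> path5_walk m %% 3 <> 2.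
      by move=> /even_halfK <-; rewrite path5_walk_even; case: thue_morse.
    have [ltj|gej] := ltnP j.*2.+1 (i + p).
      have := sq (j.*2.+1 - i); rewrite addnAC subnKC => [->|]; try lia.
      by apply: ne2; lia.
    have := sq (j.*2.+1 - (i + p)); rewrite subnKC // => <-; try lia.
    by apply: ne2; lia.
  by rewrite path5_walk_odd; do 2![case: thue_morse].
(* A square of period 1 contains a single odd time and is excluded by inspection. A longer one
   contains two consecutive odd times, hence a run xxx, an overlap of period 1. *)
have [p1|p_gt2] : p = 1 \/ 2 < p by lia.
  have := sq 0 p_gt0; rewrite p1 !addn0 addn1.
  rewrite -(odd_double_half i); case: odd; rewrite ?add0n ?add1n.
    rewrite -doubleS path5_walk_even path5_walk_odd.
    by do 2![case: thue_morse].
  by rewrite path5_walk_even path5_walk_odd; do 2![case: thue_morse].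
apply: (@thue_morse_overlap_free i./2 1) => // -[|[|//]] _.
  by rewrite !addn0 addn1 [RHS]eq_adj //; lia.
by rewrite !addn1 [RHS]eq_adj //; lia.
Qed.

Lemma path5_walk_mod4_squarefree : squarefree (fun k => path5_walk k %% 4).
Proof.
move=> i p p_gt0 sq.
have p_odd : odd p.
  apply: (@interleave_square_odd _ (fun x : bool => x.*2.+1 %% 4)
    (fun x y : bool => (x + y).*2 %% 4) (fun k => path5_walk k %% 4) i p) => //.
  - by move=> j; rewrite path5_walk_even.
  - by move=> j; rewrite path5_walk_odd.
  - by do 2!case.
  - by do 3!case.
  - by do 3!case.
(* Reduction modulo 4 keeps the parity of the vertex, which is opposite to that of the time; an odd
   period would match letters of different parity. *)
have parity k : odd (path5_walk k %% 4) = ~~ odd k.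
  by rewrite /path5_walk; case: (odd k); do 2?[case: thue_morse].
have := congr1 odd (sq 0 p_gt0); rewrite !parity !addn0 oddD p_odd.
by case: odd.
Qed.

Lemma squarefree_inord (k : nat) (z : nat -> nat) :
  (forall i, z i < k.+1) -> squarefree z ->
  squarefree (fun i => inord (z i) : 'I_k.+1).
Proof.
move=> ltzk sqf; apply: (@squarefree_comp _ _ (@nat_of_ord k.+1)).
by apply: eq_squarefree sqf => i /=; rewrite inordK.
Qed.

Lemma square_free_colourable_id (n : nat) (G : rel 'I_n) (w : inf_word n) :
  G_word G w -> squarefree w -> square_free_colourable G n.
Proof. by move=> Gw sqf; exists w, id; split=> //; apply/square_freeP. Qed.

Lemma path5_colourable : square_free_colourable (@path_graph 5) 3.
Proof.
exists (fun k => inord (path5_walk k)), (fun x => inord (x %% 3)); split.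
  move=> k; rewrite /path_graph !inordK ?path5_walk_lt5 //.
  by case: (path5_walk_adj k) => ->; rewrite eqxx ?orbT.
apply/square_freeP; apply: eq_squarefree (squarefree_inord _ path5_walk_mod3_squarefree).
  by move=> k /=; rewrite inordK ?path5_walk_lt5.
by move=> k; rewrite ltn_mod.
Qed.

Lemma cycle3_colourable : square_free_colourable (@cycle_graph 3) 3.
Proof.
have sqf := path5_walk_mod3_squarefree.
apply: (square_free_colourable_id (w := fun k => inord (path5_walk k %% 3))).
  move=> k; have := squarefree_adj (i := k) sqf.
  rewrite /cycle_graph !inordK ?ltn_mod //.
  have := ltn_pmod (path5_walk k) (isT : 0 < 3).
  have := ltn_pmod (path5_walk k.+1) (isT : 0 < 3).
  by case: (_ %% 3) => [|[|[|//]]] _; case: (_ %% 3) => [|[|[|//]]].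
by apply: squarefree_inord sqf => k; rewrite ltn_mod.
Qed.

Lemma cycle4_colourable : square_free_colourable (@cycle_graph 4) 4.
Proof.
have sqf := path5_walk_mod4_squarefree.
apply: (square_free_colourable_id (w := fun k => inord (path5_walk k %% 4))).
  move=> k; rewrite /cycle_graph !inordK ?ltn_mod //.
  by case: (path5_walk_adj k) => ->; lia.
by apply: squarefree_inord sqf => k; rewrite ltn_mod.
Qed.

(** The centre is visited at even times and the leaves at odd times. An odd period would match the
    centre with a leaf; an even one halves to a square in the ternary word [c]. *)
Lemma claw_colourable : square_free_colourable claw 4.
Proof.
pose c k := path5_walk k %% 3.
pose z k := if odd k then (c k./2).+1 else 0.
have c_lt3 k : c k < 3 by rewrite ltn_mod.
have z_lt4 k : z k < 4 by rewrite /z; case: ifP => // _; apply: c_lt3.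
apply: (square_free_colourable_id (w := fun k => inord (z k))).
  by move=> k; rewrite /claw !inordK // /z /=; case: (odd k).
apply: squarefree_inord => // i p p_gt0 sq.
have [p_odd|p_even] := boolP (odd p).
  by have := sq 0 p_gt0; rewrite !addn0 /z oddD p_odd; case: (odd i).
apply: (path5_walk_mod3_squarefree (i := i./2) (p := p./2)) => [|j ltj]; first by lia.
(* The offset [~~ odd i] leads to the first odd time of the square. *)
have /sq : (~~ odd i) + j.*2 < p by lia.
rewrite /z ifT; last by lia.
rewrite ifT; last by lia.
move/succn_inj; congr (c _ = c _); lia.
Qed.

(** * Obstructions to square-freeness *)

(** The newest letter comes first, so extending a walk is a cons and only squares at the head need
    testing. *)
Fixpoint rev_prefix (T : Type) (z : nat -> T) (m : nat) : seq T :=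
  if m is m'.+1 then z m' :: rev_prefix z m' else [::].

Lemma size_rev_prefix (T : Type) (z : nat -> T) m : size (rev_prefix z m) = m.
Proof. by elim: m => //= m ->. Qed.

Lemma nth_rev_prefix (T : Type) x0 (z : nat -> T) m j :
  j < m -> nth x0 (rev_prefix z m) j = z (m - j.+1).
Proof. by elim: m j => // m IH [|j] ltjm /=; rewrite ?subn1 // IH. Qed.

Definition head_square (s : seq nat) : bool :=
  has (fun p => take p s == take p (drop p s)) (iota 1 (size s)./2).

Lemma squarefree_head_square z m : squarefree z -> ~~ head_square (rev_prefix z m).
Proof.
move=> sqf; apply/hasP=> -[p]; rewrite mem_iota size_rev_prefix => p_lt /eqP eqp.
apply: (sqf (m - p.*2) p) => [|j ltjp]; first by lia.
have := congr1 (fun s => nth 0 s (p - j.+1)) eqp.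
rewrite !nth_take ?nth_drop; try lia.
rewrite !nth_rev_prefix; try lia.
have -> : m - (p - j.+1).+1 = m - p.*2 + p + j by lia.
by have -> : m - (p + (p - j.+1)).+1 = m - p.*2 + j by lia.
Qed.

Definition path4_next (s : seq nat) : seq nat :=
  if s is y :: _ then [seq x <- iota 0 4 | (x == y.+1) || (y == x.+1)]
  else iota 0 4.

(* Depth-first search over the walks on the path 0-1-2-3 extending the reversed
   walk [s]; it succeeds if no extension by [k] letters is square-free. *)
Fixpoint path4_search (k : nat) (s : seq nat) : bool :=
  head_square s ||
  (if k is k'.+1 then all (fun x => path4_search k' (x :: s)) (path4_next s)
   else false).

(** The prefixes of a square-free walk would be a branch that the search cannot close at any depth,
    but by computation depth 20 closes all branches. *)
Lemma path4_not_squarefree (z : nat -> nat) :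
  (forall i, z i < 4) -> (forall i, z i.+1 = (z i).+1 \/ z i = (z i.+1).+1) ->
  ~ squarefree z.
Proof.
move=> z_lt4 adj sqf.
have search k : forall m, ~~ path4_search k (rev_prefix z m).
  elim: k => [|k IH] m /=; rewrite negb_or (squarefree_head_square _ sqf) //=.
  apply/allPn; exists (z m); last exact: (IH m.+1).
  case: m => [|m]; first by rewrite mem_iota z_lt4.
  rewrite mem_filter mem_iota z_lt4 andbT.
  by case: (adj m) => ->; rewrite eqxx ?orbT.
by have /negP := search 20 0; apply; vm_compute.
Qed.

(** As [s] is closed under adjacency and [G] is symmetric, the walk stays in [s] before and after
    time [i0]; positions in [s] then turn it into a walk on 0-1-2-3. *)
Lemma closed_path4_not_squarefree (T : eqType) (G : rel T) (w : nat -> T) (s : seq T) i0 :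
  symmetric G -> (forall i, G (w i) (w i.+1)) -> uniq s -> size s <= 4 ->
  (forall x0 i j, i < size s -> j < size s -> G (nth x0 s i) (nth x0 s j) ->
     j = i.+1 \/ i = j.+1) ->
  (forall a b, G a b -> a \in s -> b \in s) -> w i0 \in s -> ~ squarefree w.
Proof.
move=> G_sym Gw s_uniq s_le4 s_path s_closed w_i0 sqf.
have w_s0 i : (w i \in s) = (w 0 \in s).
  elim: i => // i <-; apply/idP/idP; apply: s_closed; [rewrite G_sym|]; exact: Gw.
have w_s i : w i \in s by rewrite w_s0 -(w_s0 i0).
have idx i : index (w i) s < size s by rewrite index_mem.
apply: (@path4_not_squarefree (fun i => index (w i) s)) => [i|i|].
- exact: leq_trans (idx i) s_le4.
- by apply: (s_path (w 0)); rewrite ?idx // !nth_index.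
apply: (@squarefree_comp _ _ (nth (w 0) s)).
by apply: eq_squarefree sqf => i /=; rewrite nth_index.
Qed.

(* If every other letter is the same, the remaining letters form a square-free
   word that misses it. *)
Lemma alternating_not_squarefree (z : nat -> nat) b x :
  (forall i, z i < 3) -> (forall i, z (b + i.*2) = x) -> ~ squarefree z.
Proof.
move=> z_lt3 z_x sqf.
apply: (@squarefree_binary _ (fun i => z (b + i.*2.+1)) (x.+1 %% 3) (x.+2 %% 3)).
  move=> i; have := squarefree_adj (i := b + i.*2) sqf.
  have := z_lt3 (b + i.*2).+1; have := z_lt3 (b + i.*2); rewrite z_x addnS.
  by move: (z _) => y; lia.
(* A square of period [p] among the remaining letters spreads to one of period 2p in [z], since the
   letters in between all equal [x]. *)
move=> i p p_gt0 sq; apply: (sqf (b + i.*2.+1) p.*2) => [|j ltj]; first by lia.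
have [ij_odd|j_even] := boolP (odd j); last first.
  have h := sq j./2; rewrite -(even_halfK j_even) in ltj *.
  have -> : b + i.*2.+1 + j./2.*2 = b + (i + j./2).*2.+1 by lia.
  by rewrite h; [congr z|]; lia.
have -> : b + i.*2.+1 + j = b + (i + j./2.+1).*2 by lia.
have -> : b + i.*2.+1 + p.*2 + j = b + (i + p + j./2.+1).*2 by lia.
by rewrite !z_x.
Qed.

(** * Subgraphs *)

Section PartialInverse.

Variables (S : finType) (T : eqType) (f : S -> T) (y0 : S).

(** Outside the image of [f] the value is the default [y0]. *)
Definition partial_inv (x : T) : S := odflt y0 [pick y | f y == x].

Lemma partial_invKr y : f (partial_inv (f y)) = f y.
Proof. by rewrite /partial_inv; case: pickP => [z /eqP|/(_ y)/eqP]. Qed.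

Lemma partial_invK : injective f -> cancel f partial_inv.
Proof. by move=> f_inj y; apply: f_inj; rewrite partial_invKr. Qed.

End PartialInverse.

Lemma has_connected_subgraphW (T U : finType) (G : rel T) (H : rel U) :
  has_connected_subgraph G H -> has_subgraph G H.
Proof. by case=> V [F [subF _ isoF]]; exists V, F. Qed.

Lemma has_subgraphP (T U : finType) (G : rel T) (H : rel U) :
  has_subgraph G H -> exists2 f : U -> T, injective f & forall x y, H x y -> G (f x) (f y).
Proof.
case=> V [F [[_ subF] [f [f_inj _ fH]]]]; exists f => // x y.
by rewrite -fH => /subF[].
Qed.

Lemma has_connected_subgraph_intro (T U : finType) (G : rel T) (H : rel U)
    (f : U -> T) :
  symmetric H -> (forall x y, connect H x y) -> injective f ->
  (forall x y, H x y -> G (f x) (f y)) -> has_connected_subgraph G H.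
Proof.
move=> H_sym H_conn f_inj fH.
pose F (a b : T) := [exists x, exists y, [&& f x == a, f y == b & H x y]].
have F_f x y : F (f x) (f y) = H x y.
  apply/existsP/idP => [[x' /existsP[y' /and3P[/eqP/f_inj-> /eqP/f_inj->]]] //|Hxy].
  by exists x; apply/existsP; exists y; rewrite !eqxx.
have FP a b : F a b -> exists x y, [/\ a = f x, b = f y & H x y].
  by move=> /existsP[x /existsP[y /and3P[/eqP<- /eqP<- Hxy]]]; exists x, y.
exists (f @: [set: U]), F; split.
- split=> [a b|a b /FP[x [y [-> -> /fH]]]]; last by rewrite !imset_f.
  by apply/idP/idP => /FP[x [y [-> -> Hxy]]]; rewrite F_f H_sym.
- move=> _ _ /imsetP[x _ ->] /imsetP[y _ ->].
  case/connectP: (H_conn x y) => p; elim: p x => [|z p IH] x /=.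
    by move=> _ ->; apply: connect0.
  case/andP=> Hxz pth ylast; apply: connect_trans (IH _ pth ylast).
  by apply: connect1; rewrite F_f.
- by exists f.
Qed.

Lemma square_free_colourable_subgraph (n m k : nat) (G : rel 'I_n) (H : rel 'I_m) :
  has_subgraph G H -> square_free_colourable H k -> square_free_colourable G k.
Proof.
case/has_subgraphP=> f f_inj fH [w [phi [Hw sqf]]].
(* Vertices outside the image of [f] get the colour of [w 0]; the walk never visits them. *)
exists (f \o w), (phi \o partial_inv f (w 0)); split.
  by move=> j; apply: fH.
apply/square_freeP; move/square_freeP: sqf; apply: eq_squarefree => i /=.
by rewrite partial_invK.
Qed.

Lemma square_free_colourable_iso (n m k : nat) (G : rel 'I_n) (H : rel 'I_m.+1) :
  graph_iso [set: 'I_n] G H -> square_free_colourable G k ->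
  square_free_colourable H k.
Proof.
case=> f [f_inj f_onto fH] [w [phi [Gw sqf]]].
have fK x : f (partial_inv f ord0 x) = x.
  have : x \in f @: [set: 'I_m.+1] by rewrite f_onto inE.
  by case/imsetP=> y _ ->; rewrite partial_invKr.
exists (partial_inv f ord0 \o w), (phi \o f); split.
  by move=> j; rewrite -fH /= !fK.
by apply/square_freeP; move/square_freeP: sqf; apply: eq_squarefree => i /=; rewrite fK.
Qed.

Lemma has_subgraph_iso (T U : finType) (G : rel T) (H : rel U) :
  symmetric G -> graph_iso [set: T] G H -> has_subgraph G H.
Proof. by move=> G_sym isoG; exists [set: T], G; split=> //; split=> // x y; rewrite !inE. Qed.

Lemma square_free_colourable_word (n k : nat) (G : rel 'I_n) :
  square_free_colourable G k -> exists w : inf_word n, G_word G w /\ square_free w.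
Proof.
case=> w [phi [Gw /square_freeP sqf]]; exists w; split=> //.
by apply/square_freeP; apply: squarefree_comp sqf.
Qed.

(** Following smaller neighbours leads from every vertex down to 0. *)
Lemma connected_of_parent (m : nat) (H : rel 'I_m.+1) :
  symmetric H ->
  (forall x : 'I_m.+1, 0 < x -> exists2 y : 'I_m.+1, y < x & H y x) ->
  forall x y, connect H x y.
Proof.
move=> H_sym parent.
have conn0 k : forall x : 'I_m.+1, x = k :> nat -> connect H ord0 x.
  elim/ltn_ind: k => k IH x xk; have [x0|x_gt0] := posnP x.
    by have -> : x = ord0 by apply: val_inj; rewrite /= x0.
  have [y ltyx Hyx] := parent x x_gt0.
  by apply: connect_trans (IH y _ y erefl) (connect1 Hyx); rewrite -xk.
move=> x y; apply: connect_trans (conn0 y y erefl).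
by rewrite (sym_connect_sym H_sym) (conn0 x x erefl).
Qed.

Lemma path_graph_sym m : symmetric (@path_graph m).
Proof. by move=> x y; rewrite /path_graph orbC. Qed.

Lemma cycle_graph_sym m : symmetric (@cycle_graph m).
Proof. by move=> x y; rewrite /cycle_graph orbC. Qed.

Lemma claw_sym : symmetric claw.
Proof. by move=> x y; rewrite /claw orbC. Qed.

Lemma path_graph_connected m (x y : 'I_m.+1) : connect (@path_graph m.+1) x y.
Proof.
apply: connected_of_parent => [|{}x x_gt0]; first exact: path_graph_sym.
have x_lt := ltn_ord x; exists (inord x.-1); rewrite /path_graph inordK; lia.
Qed.

Lemma path_cycle_graph m : subrel (@path_graph m) (@cycle_graph m).
Proof.
move=> x y; rewrite /path_graph /cycle_graph => /orP[]/eqP xy; apply/orP.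
  by left; rewrite -xy modn_small.
by right; rewrite -xy modn_small.
Qed.

Lemma cycle_graph_connected m (x y : 'I_m.+1) : connect (@cycle_graph m.+1) x y.
Proof.
apply: (@connect_sub _ (@path_graph m.+1)) (path_graph_connected x y) => {}x {}y.
by move/path_cycle_graph; apply: connect1.
Qed.

Lemma claw_connected x y : connect claw x y.
Proof.
apply: connected_of_parent => [|{}x x_gt0]; first exact: claw_sym.
by exists ord0 => //; rewrite /claw -lt0n x_gt0.
Qed.

Lemma has_connected_subgraph_seq (T : finType) (G : rel T) (m : nat) (H : rel 'I_m)
    (x0 : T) (s : seq T) :
  symmetric H -> (forall x y, connect H x y) -> uniq s -> size s = m ->
  (forall i j, H i j -> G (nth x0 s i) (nth x0 s j)) ->
  has_connected_subgraph G H.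
Proof.
move=> H_sym H_conn s_uniq s_size HG.
apply: (has_connected_subgraph_intro (f := fun i : 'I_m => nth x0 s i)) => // i j.
by move/eqP; rewrite nth_uniq ?s_size // => /eqP/val_inj.
Qed.

Lemma has_path5_of_path (T : finType) (G : rel T) (m : nat) :
  5 <= m -> has_subgraph G (@path_graph m) ->
  has_connected_subgraph G (@path_graph 5).
Proof.
move=> m_ge5 /has_subgraphP[f f_inj fG].
apply: (has_connected_subgraph_intro (f := f \o widen_ord m_ge5)).
- exact: path_graph_sym.
- exact: path_graph_connected.
- by move=> x y /f_inj/(congr1 val)/=; apply: val_inj.
- by move=> x y Hxy; apply: fG.
Qed.

Lemma has_path_of_cycle (T : finType) (G : rel T) (m : nat) :
  has_subgraph G (@cycle_graph m.+1) -> has_connected_subgraph G (@path_graph m.+1).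
Proof.
move=> /has_subgraphP[f f_inj fG].
apply: (has_connected_subgraph_intro (f := f)) => //.
- exact: path_graph_sym.
- exact: path_graph_connected.
- by move=> x y /path_cycle_graph; apply: fG.
Qed.

(** * Small subgraphs met by a square-free walk *)

Section SmallSubgraphs.

Variables (T : finType) (G : rel T).
Hypotheses (G_sym : symmetric G) (G_irr : irreflexive G).

Lemma adj_neq x y : G x y -> x != y.
Proof. by move=> Gxy; apply: contraTneq Gxy => ->; rewrite G_irr. Qed.

Lemma has_cycle3 x y z :
  G x y -> G y z -> G x z -> has_connected_subgraph G (@cycle_graph 3).
Proof.
move=> Gxy Gyz Gxz; apply: (@has_connected_subgraph_seq _ _ _ _ x [:: x; y; z]) => //.
- exact: cycle_graph_sym.
- exact: cycle_graph_connected.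
- by rewrite /= !inE negb_or !adj_neq.
- by case=> [[|[|[|//]]] ?] [[|[|[|//]]] ?] //= _; rewrite // G_sym.
Qed.

Lemma has_cycle4 a b c d : uniq [:: a; b; c; d] ->
  G a b -> G b c -> G c d -> G a d -> has_connected_subgraph G (@cycle_graph 4).
Proof.
move=> s_uniq Gab Gbc Gcd Gad.
apply: (@has_connected_subgraph_seq _ _ _ _ a [:: a; b; c; d]) => //.
- exact: cycle_graph_sym.
- exact: cycle_graph_connected.
- by case=> [[|[|[|[|//]]]] ?] [[|[|[|[|//]]]] ?] //= _; rewrite // G_sym.
Qed.

Lemma has_path5 a b c d e : uniq [:: a; b; c; d; e] ->
  G a b -> G b c -> G c d -> G d e -> has_connected_subgraph G (@path_graph 5).
Proof.
move=> s_uniq Gab Gbc Gcd Gde.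
apply: (@has_connected_subgraph_seq _ _ _ _ a [:: a; b; c; d; e]) => //.
- exact: path_graph_sym.
- exact: path_graph_connected.
- by case=> [[|[|[|[|[|//]]]]] ?] [[|[|[|[|[|//]]]]] ?] //= _; rewrite // G_sym.
Qed.

Lemma has_claw o a b c : uniq [:: a; b; c] ->
  G o a -> G o b -> G o c -> has_connected_subgraph G claw.
Proof.
move=> s_uniq Goa Gob Goc.
apply: (@has_connected_subgraph_seq _ _ _ _ o [:: o; a; b; c]) => //.
- exact: claw_sym.
- exact: claw_connected.
- by rewrite cons_uniq s_uniq !inE !negb_or !adj_neq.
- by case=> [[|[|[|[|//]]]] ?] [[|[|[|[|//]]]] ?] //= _; rewrite // G_sym.
Qed.

(** The 5-cycle is left out because it contains the path on five vertices. *)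
Definition has_small_subgraph : Prop :=
  has_connected_subgraph G (@cycle_graph 3) \/
  has_connected_subgraph G (@cycle_graph 4) \/
  has_connected_subgraph G (@path_graph 5) \/
  has_connected_subgraph G claw.

Variable w : nat -> T.
Hypotheses (Gw : forall i, G (w i) (w i.+1)) (sqf : squarefree w).

(** A chord gives a triangle or a 4-cycle. An edge leaving the path gives a claw at an inner vertex
    and a longer path at an end. Otherwise the walk is confined to an induced path on four vertices
    and has a square. *)
Lemma small_subgraph_of_path4 a b c d i : uniq [:: a; b; c; d] ->
  G a b -> G b c -> G c d -> w i \in [:: a; b; c; d] -> has_small_subgraph.
Proof.
move=> s_uniq Gab Gbc Gcd w_s; set s := [:: a; b; c; d] in s_uniq w_s.
have [Gac|nGac] := boolP (G a c); first by left; exact: has_cycle3 Gab Gbc Gac.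
have [Gbd|nGbd] := boolP (G b d); first by left; exact: has_cycle3 Gbc Gcd Gbd.
have [Gad|nGad] := boolP (G a d); first by right; left; exact: has_cycle4 s_uniq Gab Gbc Gcd Gad.
have [/existsP[x /existsP[u /and3P[xs us Gxu]]]|closed] :=
    boolP [exists x, exists u, [&& x \in s, u \notin s & G x u]].
  move: (us) (s_uniq); rewrite !inE !negb_or => /and4P[ua ub uc ud].
  rewrite /= !inE !negb_or !andbT => /and3P[/and3P[ab ac ad] /andP[bc bd] cd].
  move: xs Gxu; rewrite !inE => /or4P[]/eqP-> Gu.
  - right; right; left; apply: (@has_path5 u a b c d) => //; last by rewrite G_sym.
    by rewrite cons_uniq us.
  - right; right; right; apply: (@has_claw b a c u) => //; last 1 first.
    + by rewrite G_sym.
    by rewrite /= !inE !negb_or ac ![_ == u]eq_sym ua uc.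
  - right; right; right; apply: (@has_claw c b d u) => //; last 1 first.
    + by rewrite G_sym.
    by rewrite /= !inE !negb_or bd ![_ == u]eq_sym ub ud.
  - right; right; left; apply: (@has_path5 u d c b a) => //; try by rewrite G_sym.
    rewrite cons_uniq (perm_uniq (_ : perm_eq _ (rev s))) ?rev_uniq ?s_uniq //.
    by rewrite !inE !negb_or ua ub uc ud.
exfalso; apply: (closed_path4_not_squarefree G_sym Gw s_uniq _ _ _ w_s sqf) => //.
- move=> x0 [|[|[|[|//]]]] [|[|[|[|//]]]] _ _ /=; rewrite ?G_irr; auto;
    by rewrite ?(negPf nGac) ?(negPf nGbd) ?(negPf nGad) // G_sym
               ?(negPf nGac) ?(negPf nGbd) ?(negPf nGad).
- move=> x u Gxu xs; apply: contraNT closed => us.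
  by apply/existsP; exists x; apply/existsP; exists u; rewrite xs us.
Qed.

Lemma small_subgraph_of_squarefree_walk : has_small_subgraph.
Proof.
(* If the walk turned back at both of its first two opportunities, it would begin with a square of
   period 2. *)
have [i wi2] : exists i, w i.+2 != w i.
  have [e0|] := eqVneq (w 2) (w 0); last by exists 0.
  have [e1|] := eqVneq (w 3) (w 1); last by exists 1.
  by exfalso; apply: (sqf (i := 0) (p := 2)) => // -[|[|//]].
have [x [y [z [Gxy Gyz zx xi]]]] :
    exists x y z, [/\ G x y, G y z, z != x & x = w i].
  by exists (w i), (w i.+1), (w i.+2).
have [Gxz|nGxz] := boolP (G x z); first by left; exact: has_cycle3 Gxy Gyz Gxz.
have yx := adj_neq Gxy; have yz := adj_neq Gyz.
set s := [:: x; y; z]; have s_uniq : uniq s.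
  by rewrite /= !inE negb_or yx yz eq_sym zx.
have xs : x \in s by rewrite inE eqxx.
(* An edge leaving [s] gives a claw at the middle vertex and a path on four vertices at an end. *)
have [/existsP[a /existsP[u /and3P[a_s us Gau]]]|closed] :=
    boolP [exists a, exists u, [&& a \in s, u \notin s & G a u]].
  move: (us); rewrite !inE !negb_or => /and3P[ux uy uz].
  move: a_s Gau; rewrite !inE => /or3P[]/eqP-> Gu.
  - apply: (@small_subgraph_of_path4 u x y z i) => //.
    + by rewrite cons_uniq us.
    + by rewrite G_sym.
    + by rewrite -xi !inE eqxx orbT.
  - right; right; right; apply: (@has_claw y x z u) => //; last 1 first.
    + by rewrite G_sym.
    by rewrite /= !inE !negb_or [x == z]eq_sym zx ![_ == u]eq_sym ux uz.
  - apply: (@small_subgraph_of_path4 x y z u i) => //.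
    + by rewrite -[_ :: _]/(rcons s u) rcons_uniq us.
    + by rewrite -xi inE eqxx.
exfalso; apply: (closed_path4_not_squarefree (i0 := i) G_sym Gw s_uniq _ _ _ _ sqf) => //.
- move=> x0 [|[|[|//]]] [|[|[|//]]] _ _ /=; rewrite ?G_irr; auto;
    by rewrite ?(negPf nGxz) // G_sym (negPf nGxz).
- move=> a u Gau a_s; apply: contraNT closed => us.
  by apply/existsP; exists a; apply/existsP; exists u; rewrite a_s us.
- by rewrite -xi.
Qed.

End SmallSubgraphs.

(** * Lower bounds on the number of colours *)

Lemma colourable_gt2 (n k : nat) (G : rel 'I_n) :
  square_free_colourable G k -> 2 < k.
Proof.
case=> w [phi [_ /square_freeP sqf]]; rewrite ltnNge; apply/negP=> k_le2.
have {}sqf := squarefree_inj (@ord_inj k) sqf.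
apply: (squarefree_binary (x := 0) (y := 1)) sqf => i /=.
by have := leq_trans (ltn_ord (phi (w i))) k_le2; case: (nat_of_ord _) => [|[|]]; auto.
Qed.

(** Every other step is at the centre, so its colour fills one parity class of times. *)
Lemma claw_colourable_gt3 (k : nat) : square_free_colourable claw k -> 3 < k.
Proof.
case=> w [phi [Hw /square_freeP sqf]]; rewrite ltnNge; apply/negP=> k_le3.
have {}sqf := squarefree_inj (@ord_inj k) sqf.
have [b wb0] : exists b, w b = ord0.
  case/orP: (Hw 0) => /andP[/eqP w0 _]; [exists 0 | exists 1]; exact: val_inj.
apply: (alternating_not_squarefree (b := b) (x := phi ord0)) sqf => i /=.
  exact: leq_trans (ltn_ord _) k_le3.
suff -> : w (b + i.*2) = ord0 by [].
elim: i => [|i IH]; first by rewrite addn0.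
have back x y : claw ord0 x -> claw x y -> y = ord0.
  by move=> c0x cxy; apply: val_inj; move: c0x cxy; rewrite /claw /=; lia.
by rewrite doubleS !addnS; apply: back (Hw _); rewrite -IH.
Qed.

(** The walk alternates between the two pairs of opposite vertices. If such a pair had a single
    colour, that colour would fill every other step. Otherwise three colours force two adjacent
    vertices to agree. *)
Lemma cycle4_colourable_gt3 (k : nat) :
  square_free_colourable (@cycle_graph 4) k -> 3 < k.
Proof.
case=> w [phi [Hw /square_freeP sqf]]; rewrite ltnNge; apply/negP=> k_le3.
have {}sqf := squarefree_inj (@ord_inj k) sqf.
pose c j : nat := phi (inord j); pose v i : nat := w i.
have c_lt3 j : c j < 3 by apply: leq_trans (ltn_ord _) k_le3.
have v_lt4 i : v i < 4 by apply: ltn_ord.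
have {}sqf : squarefree (c \o v).
  by apply: eq_squarefree sqf => i; rewrite /c /v /= inord_val.
have v_adj i : v i.+1 = (v i).+1 %% 4 \/ v i = (v i.+1).+1 %% 4.
  by case/orP: (Hw i) => /eqP; auto.
have alternating q : ~ (forall i j, i < 4 -> j < 4 -> odd i = q -> odd j = q -> c i = c j).
  move=> c_q; have [b vb] : exists b, odd (v b) = q.
    have [|v0] := eqVneq (odd (v 0)) q; first by exists 0.
    by exists 1; have := v_adj 0; have := v_lt4 0; lia.
  have v_par i : odd (v (b + i.*2)) = q.
    elim: i => [|i IH]; first by rewrite addn0.
    rewrite doubleS !addnS -IH.
    by have := v_adj (b + i.*2); have := v_adj (b + i.*2).+1; lia.
  apply: (alternating_not_squarefree (b := b) (x := c (v b))) sqf => i //=.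
  by apply: c_q.
have c02 : c 0 <> c 2.
  by move=> c02; apply: (alternating false) => -[|[|[|[|//]]]] [|[|[|[|//]]]].
have c13 : c 1 <> c 3.
  by move=> c13; apply: (alternating true) => -[|[|[|[|//]]]] [|[|[|[|//]]]].
(* Two adjacent vertices share a colour, so the walk never uses that edge and
   stays on the path obtained by deleting it. *)
have [e [e_lt4 c_e]] : exists e, e < 4 /\ c e = c (e.+1 %% 4).
  have := c_lt3 0; have := c_lt3 1; have := c_lt3 2; have := c_lt3 3.
  have [?|?] := eqVneq (c 0) (c 1); first by exists 0.
  have [?|?] := eqVneq (c 1) (c 2); first by exists 1.
  have [?|?] := eqVneq (c 2) (c 3); first by exists 2.
  by exists 3; rewrite modnn; lia.
apply: (@path4_not_squarefree (fun i => (v i + (3 - e)) %% 4)).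
- by move=> i; rewrite ltn_mod.
- move=> i; have /= c_adj := squarefree_adj (i := i) sqf.
  have unused : ~ (v i = e /\ v i.+1 = e.+1 %% 4).
    by case=> vi vi1; apply: c_adj; rewrite vi vi1.
  have unused' : ~ (v i.+1 = e /\ v i = e.+1 %% 4).
    by case=> vi1 vi; apply: c_adj; rewrite vi vi1.
  have := v_adj i; have := v_lt4 i; have := v_lt4 i.+1; lia.
apply: (@squarefree_comp _ _ (fun x => c ((x + e.+1) %% 4))).
apply: eq_squarefree sqf => i /=; congr c.
by have := v_lt4 i; lia.
Qed.

(** * The characterisation and the values of gamma *)

Theorem theorem1 (n : nat) (G : rel 'I_n)
    (G_sym : symmetric G) (G_irr : irreflexive G) :
  ((exists w : inf_word n, G_word G w /\ square_free w) <->
   (has_connected_subgraph G (@cycle_graph 3) \/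
    has_connected_subgraph G (@cycle_graph 4) \/
    has_connected_subgraph G (@cycle_graph 5) \/
    has_connected_subgraph G (@path_graph 5) \/
    has_connected_subgraph G claw)) /\
  (has_subgraph G (@cycle_graph 3) \/
   (exists m : nat, 5 <= m /\ has_subgraph G (@path_graph m)) ->
   gamma_is G 3) /\
  (graph_iso [set: 'I_n] G (@cycle_graph 4) \/
   graph_iso [set: 'I_n] G claw ->
   gamma_is G 4).
Proof.
have colour k m (H : rel 'I_m) := @square_free_colourable_subgraph n m k G H.
have path5 : has_connected_subgraph G (@path_graph 5) -> square_free_colourable G 3.
  by move/has_connected_subgraphW/colour; apply; apply: path5_colourable.
split; [split | split].
- case=> w [Gw /square_freeP sqf].
  case: (small_subgraph_of_squarefree_walk G_sym G_irr Gw sqf) => [|[|[|]]]; tauto.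
- case=> [|[|[|[|]]]].
  + move/has_connected_subgraphW/colour/(_ cycle3_colourable).
    exact: square_free_colourable_word.
  + move/has_connected_subgraphW/colour/(_ cycle4_colourable).
    exact: square_free_colourable_word.
  + move/has_connected_subgraphW/has_path_of_cycle/path5.
    exact: square_free_colourable_word.
  + by move/path5; apply: square_free_colourable_word.
  + move/has_connected_subgraphW/colour/(_ claw_colourable).
    exact: square_free_colourable_word.
- move=> H; split; last by move=> k'; apply: colourable_gt2.
  case: H => [/colour/(_ cycle3_colourable) //|[m [m_ge5 Pm]]].
  exact: path5 (has_path5_of_path m_ge5 Pm).
- case=> iso; (split; first apply: colour (has_subgraph_iso G_sym iso) _).
  + exact: cycle4_colourable.
  + by move=> k' /(square_free_colourable_iso iso); apply: cycle4_colourable_gt3.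
  + exact: claw_colourable.
  + by move=> k' /(square_free_colourable_iso iso); apply: claw_colourable_gt3.
Qed.
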